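(* A permutation class $\mathcal{C}$ is a Young class if and only if there is a set $D$ of partitions that is downwards closed in the double domination order such that $\mathcal{C} = \{\pi : \mathrm{sh}(\pi) \in D\}$.
   Context: Permutations are identified with their sequences of values. For permutations $\sigma$ (of length $k$) and $\pi$, $\sigma\preceq\pi$ means some length-$k$ subsequence of the values of $\pi$ has its terms in the same relative order as the values of $\sigma$. A permutation class is a set of permutations closed downwards under $\preceq$. For a permutation $\pi$, $\mathrm{sh}(\pi)$ is the partition giving the common shape of the two Young tableaux associated to $\pi$ by the Robinson–Schensted–Knuth correspondence. A Young class is a permutation class $\mathcal{C}$ such that for each partition $\lambda$, either all permutations of shape $\lambda$ belong to $\mathcal{C}$ or none do. A partition is a weakly decreasing sequence of positive integers, regarded as extended by trailing zeros; its conjugate $\lambda^*$ is given by $\lambda^*_i=|\{j:\lambda_j\ge i\}|$. $\lambda\trianglelefteq\mu$ means $\sum_{i=1}^k\lambda_i\le\sum_{i=1}^k\mu_i$ for all $k\ge1$; the double domination order is $\lambda\sqsubseteq\mu$ iff $\lambda\trianglelefteq\mu$ and $\lambda^*\trianglelefteq\mu^*$. A set $D$ of partitions is downwards closed if $\mu\in D$ and $\lambda\sqsubseteq\mu$ imply $\lambda\in D$. *)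

(* Defs.v *)
(* MathComp world, with sets of permutations and of partitions as classical
   sets. *)
From HB Require Import structures.
From mathcomp Require Import all_boot all_fingroup.
From mathcomp Require Import classical_sets.

Set Implicit Arguments.
Unset Strict Implicit.
Unset Printing Implicit Defensive.

(** * Permutations and permutation classes *)

(* A permutation of any length n >= 0; positions and values run over
   0, ..., n-1 instead of 1, ..., n. *)
Definition permutation : Type := {n : nat & 'S_n}.

Definition plength (p : permutation) : nat := tag p.

Definition pval (p : permutation) : 'S_(plength p) := tagged p.

Definition word (p : permutation) : seq nat :=
  [seq val (pval p i) | i <- enum 'I_(plength p)].

(* f selects the positions of the subsequence of q. *)
Definition pattern (p q : permutation) : Prop :=
  exists f : 'I_(plength p) -> 'I_(plength q),
    (forall i j : 'I_(plength p), i < j -> f i < f j) /\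
    (forall i j : 'I_(plength p), (pval p i < pval p j) = (pval q (f i) < pval q (f j))).

Definition perm_class (C : set permutation) : Prop :=
  forall p q, C q -> pattern p q -> C p.

(** * Partitions *)

Definition is_part (l : seq nat) : bool := sorted geq l && (0 \notin l).

Record intpart : Type := IntPart { parts :> seq nat; _ : is_part parts }.

HB.instance Definition _ := [isSub for parts].
HB.instance Definition _ := [Equality of intpart by <:].

(* The entry at index i (counted from 0) is the number of parts >= i.+1;
   it vanishes from i = head 0 l, the largest part, onwards. *)
Definition conj_seq (l : seq nat) : seq nat :=
  mkseq (fun i => count (leq i.+1) l) (head 0 l).

Lemma conj_seqP (l : intpart) : is_part (conj_seq l).
Proof.
rewrite /is_part /conj_seq; apply/andP; split.
  apply/(sortedP 0) => i; rewrite size_mkseq => lt_i.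
  rewrite !nth_mkseq //; last exact: ltnW.
  by apply: sub_count => x /=; apply: ltnW.
apply/mapP => -[i]; rewrite mem_iota /= add0n.
by case: (parts l) => [|a s] //= ->.
Qed.

Definition conj_part (l : intpart) : intpart := IntPart (conj_seqP l).

Definition dominated (l m : intpart) : Prop :=
  forall k, \sum_(i < k) nth 0 l i <= \sum_(i < k) nth 0 m i.

Definition double_dominated (l m : intpart) : Prop :=
  dominated l m /\ dominated (conj_part l) (conj_part m).

Definition dd_closed (D : set intpart) : Prop :=
  forall l m, D m -> double_dominated l m -> D l.

(** * The Robinson-Schensted-Knuth correspondence *)

(* Tableaux are lists of rows, first row first.  Row insertion of x into t
   also returns the index of the row that has gained a box. *)
Fixpoint insert (t : seq (seq nat)) (x : nat) : seq (seq nat) * nat :=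
  if t is r :: t' then
    let i := find (ltn x) r in
    if i < size r then
      let: (u, k) := insert t' (nth 0 r i) in (set_nth 0 r i x :: u, k.+1)
    else (rcons r x :: t', 0)
  else ([:: [:: x]], 0).

Definition add_box (t : seq (seq nat)) (k x : nat) : seq (seq nat) :=
  set_nth [::] t k (rcons (nth [::] t k) x).

(* xm is the letter to be inserted together with its position. *)
Definition RSK_step (PQ : seq (seq nat) * seq (seq nat)) (xm : nat * nat) :=
  let: (P, k) := insert PQ.1 xm.1 in (P, add_box PQ.2 k xm.2).

Definition RSK (w : seq nat) : seq (seq nat) * seq (seq nat) :=
  foldl RSK_step ([::], [::]) (zip w (iota 0 (size w))).

(* s can be placed just below r. *)
Definition column_strict (r s : seq nat) : bool :=
  (size s <= size r) && all (fun i => nth 0 r i < nth 0 s i) (iota 0 (size s)).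

(* Rows are not required to increase: this weaker invariant is preserved by
   insertion and already makes the shape a partition. *)
Definition col_tableau (t : seq (seq nat)) : bool :=
  sorted column_strict t && ([::] \notin t).

Lemma column_strictP r s :
  reflect (size s <= size r /\ forall i, i < size s -> nth 0 r i < nth 0 s i)
          (column_strict r s).
Proof.
apply: (iffP andP) => -[le_sr /=].
  by move/allP=> lt_rs; split=> // i lt_i; apply: lt_rs; rewrite mem_iota.
by move=> lt_rs; split=> //; apply/allP => i; rewrite mem_iota; apply: lt_rs.
Qed.

Lemma col_tableau_cons r t : col_tableau (r :: t) =
  [&& r != [::], col_tableau t & (if t is s :: _ then column_strict r s else true)].
Proof.
rewrite /col_tableau inE negb_or eq_sym; case: t => [|s t] /=; first by rewrite andbT.
by case: (column_strict r s); case: (r == _); rewrite //= ?andbF ?andbT.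
Qed.

Lemma column_strict_rcons r s x : column_strict r s -> column_strict (rcons r x) s.
Proof.
case/column_strictP=> le_sr lt_rs; apply/column_strictP.
rewrite size_rcons; split=> [|i lt_i]; first exact: leqW.
by rewrite nth_rcons (leq_trans lt_i le_sr) lt_rs.
Qed.

Lemma bump_first r x (i := find (ltn x) r) : i < size r ->
  [/\ x < nth 0 r i, size (set_nth 0 r i x) = size r &
      forall j, nth 0 (set_nth 0 r i x) j <= nth 0 r j].
Proof.
move=> lt_i; have lt_x : x < nth 0 r i by apply: nth_find; rewrite has_find.
split=> //; first by rewrite size_set_nth (maxn_idPr lt_i).
by move=> j; rewrite nth_set_nth /=; case: eqP => // ->; apply: ltnW.
Qed.

Lemma bump_nth r x (i := find (ltn x) r) j : i < size r -> j <= i ->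
  nth 0 (set_nth 0 r i x) j < nth 0 r i.
Proof.
move=> lt_i; rewrite leq_eqVlt nth_set_nth /=; have [lt_x _ _] := bump_first lt_i.
case: eqP => //= _ lt_ji; have := before_find 0 lt_ji => /= /negbT.
by rewrite -leqNgt => /leq_ltn_trans; apply.
Qed.

Lemma insert_cons r t x : let i := find (ltn x) r in
  insert (r :: t) x =
    if i < size r then
      (set_nth 0 r i x :: (insert t (nth 0 r i)).1, (insert t (nth 0 r i)).2.+1)
    else (rcons r x :: t, 0).
Proof. by move=> i; rewrite /= -/i; case: (insert t _). Qed.

Lemma insert_col_tableau t x : col_tableau t -> col_tableau (insert t x).1.
Proof.
elim: t x => [|r t IHt] x //; rewrite insert_cons col_tableau_cons.
case/and3P=> r_n0 tab_t col_rt; case: ifP => lt_i; rewrite col_tableau_cons.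
  have [lt_x sz_r le_r] := bump_first lt_i.
  apply/and3P; split; [|exact: IHt|].
    by rewrite -size_eq0 sz_r size_eq0.
  have lt_r := bump_nth lt_i; move: lt_i lt_x sz_r le_r lt_r.
  move: (find _ _) => i lt_i lt_x sz_r le_r lt_r.
  case: t {IHt} tab_t col_rt => [|s t] tab_t col_rt.
    apply/column_strictP; rewrite sz_r; split=> [|[|j]] //=.
      exact: leq_ltn_trans lt_i.
    by move=> _; apply: lt_r.
  case/column_strictP: col_rt => le_sr lt_rs; rewrite insert_cons.
  have le_j : i < size s -> find (ltn (nth 0 r i)) s <= i.
    move=> lt_is; rewrite leqNgt; apply/negP => /(before_find 0) /=.
    by rewrite lt_rs.
  case: ifP => lt_j; apply/column_strictP; rewrite sz_r.
    have [_ -> _] := bump_first lt_j; split=> // k lt_k.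
    rewrite [X in _ < X]nth_set_nth /=; case: eqP => [->|_].
      apply: lt_r; case: (ltnP i (size s)) => [/le_j //|le_si].
      exact: ltnW (leq_trans lt_j le_si).
    exact: leq_ltn_trans (le_r k) (lt_rs k lt_k).
  have le_si : size s <= i.
    rewrite leqNgt; apply/negP => lt_is; case/negP: lt_j.
    exact: leq_ltn_trans (le_j lt_is) lt_is.
  rewrite size_rcons; split=> [|k]; first exact: leq_ltn_trans lt_i.
  rewrite ltnS leq_eqVlt nth_rcons => /orP[/eqP->|lt_k].
    by rewrite ltnn eqxx lt_r.
  by rewrite lt_k; apply: leq_ltn_trans (le_r k) (lt_rs k lt_k).
apply/and3P; split=> //; first by rewrite -size_eq0 size_rcons.
by case: t col_rt {IHt tab_t} => // s t; apply: column_strict_rcons.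
Qed.

Lemma col_tableau_shape t : col_tableau t -> is_part (shape t).
Proof.
case/andP=> srt_t t_n0; apply/andP; split.
  rewrite /shape sorted_map; apply: sub_sorted srt_t => r s /column_strictP[].
  by [].
by apply: contra t_n0 => /mapP[[|y r] //].
Qed.

Lemma RSK_ind (K : seq (seq nat) * seq (seq nat) -> Prop) (w : seq nat) :
  K ([::], [::]) -> (forall PQ xm, K PQ -> K (RSK_step PQ xm)) -> K (RSK w).
Proof.
move=> K0 KS; rewrite /RSK; elim: (zip _ _) ([::], [::]) K0 => //= xm s IHs PQ K0.
exact/IHs/KS.
Qed.

Lemma RSK_shapeP (w : seq nat) : is_part (shape (RSK w).1).
Proof.
apply/col_tableau_shape; apply: (@RSK_ind (fun PQ => col_tableau PQ.1)) => // -[P Q] [x m] /= /(insert_col_tableau x).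
by rewrite /RSK_step /=; case: (insert P x).
Qed.

Lemma shape_insert t x : shape (insert t x).1 = incr_nth (shape t) (insert t x).2.
Proof.
elim: t x => [|r t IHt] x //; rewrite insert_cons; case: ifP => [lt_i|_] /=.
  by rewrite size_set_nth (maxn_idPr lt_i) -IHt.
by rewrite size_rcons.
Qed.

Lemma shape_add_box t k x : shape (add_box t k x) = incr_nth (shape t) k.
Proof.
rewrite /add_box /shape; elim: t k => [|r t IHt] [|k] //=; rewrite ?size_rcons //.
  by congr cons; elim: k => //= k ->.
by rewrite -IHt.
Qed.

Lemma RSK_common_shape (w : seq nat) : shape (RSK w).1 = shape (RSK w).2.
Proof.
apply: (@RSK_ind (fun PQ => shape PQ.1 = shape PQ.2)) => // -[P Q] [x m] /= eqPQ.
have := shape_insert P x; rewrite /RSK_step /=.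
by case: (insert P x) => P' k /= ->; rewrite shape_add_box eqPQ.
Qed.

Definition sh (p : permutation) : intpart := IntPart (RSK_shapeP (word p)).

Definition Young_class (C : set permutation) : Prop :=
  perm_class C /\
  forall l : intpart,
    (forall p, sh p = l -> C p) \/ (forall p, sh p = l -> ~ C p).

(* Main.v *)
Require Import Defs.
From mathcomp Require Import all_boot all_fingroup zify.
From mathcomp Require Import boolp classical_sets.

Set Implicit Arguments.
Unset Strict Implicit.
Unset Printing Implicit Defensive.

(* For a Young class C let D be the set of shapes of its members. What has to be
   shown is that D is closed downwards, and for this it is enough to find, for
   partitions l below m in the double domination order, some permutation of shape
   m with a pattern of shape l.
   The condition on l and m says that each partial sum of m exceeds that of l by
   an amount between 0 and d = |m| - |l|. Capping the excess at d - 1 gives an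
   intermediate partition of |m| - 1, so one may assume d = 1.
   Shapes are certified by half of Greene's theorem: if the letters of a word can
   be labelled by the boxes of l such that rows are increasing and columns are
   decreasing subsequences, then the word has shape l.
   Now permute the rows and the columns of the diagram of m as lattice lines, and
   read rows as increasing and columns as decreasing. The rows in which l and m
   differ lose and gain a box alternately; together with the columns in which
   they differ they can be arranged so as to cut out the diamond
   {|x| + |y| <= M}, with the remaining rows on top and the remaining columns on
   the left. Removing the centre of the diamond allows one to reglue its half
   rows and half columns in the shape of a pinwheel, and this labels the other
   points by the boxes of l. *)

(** * Knuth moves and families of chains *)

(** Imposed pairwise on a word, it makes every colour class below [k] an increasing subsequence. *)
Definition chain_rel k (c : nat -> nat) a b := (c a == c b) && (c a < k) ==> (a < b).

Lemma chain_relP {k c a b} : reflect (c a = c b -> c a < k -> a < b) (chain_rel k c a b).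
Proof.
apply: (iffP implyP) => [lt_ab eq_c lt_c|lt_ab /andP[/eqP]]; last exact: lt_ab.
by apply: lt_ab; rewrite eq_c eqxx -eq_c.
Qed.

(* Colours from k on mark the letters that belong to no chain. *)
Definition has_chains k s w :=
  exists2 c, pairwise (chain_rel k c) w & s = count (fun a => c a < k) w.

(* Row insertion only needs the moves in these directions, and reversal of words
   exchanges them. *)
Inductive knuth : seq nat -> seq nat -> Prop :=
| KnuthRefl w : knuth w w
| KnuthTrans v u w of knuth u v & knuth v w : knuth u w
| KnuthLeft u v x y z of x < y & y < z :
    knuth (u ++ [:: y; z; x] ++ v) (u ++ [:: y; x; z] ++ v)
| KnuthRight u v x y z of x < y & y < z :
    knuth (u ++ [:: x; z; y] ++ v) (u ++ [:: z; x; y] ++ v).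

Lemma knuth_perm u w : knuth u w -> perm_eq u w.
Proof.
elim=> {u w} [//|v u w _ uv _ vw|u v x y z _ _|u v x y z _ _].
- exact: perm_trans uv vw.
- by rewrite perm_cat2l perm_cat2r; apply/seq.permP => P /=; lia.
- by rewrite perm_cat2l perm_cat2r; apply/seq.permP => P /=; lia.
Qed.

Lemma knuth_rev u w : knuth u w -> knuth (rev u) (rev w).
Proof.
elim=> {u w} [w|v u w _ uv _ vw|u v x y z lt_xy lt_yz|u v x y z lt_xy lt_yz].
- exact: KnuthRefl.
- exact: KnuthTrans uv vw.
- by rewrite !rev_cat -!catA; apply: KnuthRight.
- by rewrite !rev_cat -!catA; apply: KnuthLeft.
Qed.

Lemma knuth_cat s t u w : knuth u w -> knuth (s ++ u ++ t) (s ++ w ++ t).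
Proof.
elim=> {u w} [w|v u w _ uv _ vw|u v x y z lt_xy lt_yz|u v x y z lt_xy lt_yz].
- exact: KnuthRefl.
- exact: KnuthTrans uv vw.
- by rewrite -!catA !(catA s); apply: KnuthLeft.
- by rewrite -!catA !(catA s); apply: KnuthRight.
Qed.

Lemma pairwise_cat3 (r : rel nat) u x y z v :
  reflect [/\ pairwise r u, pairwise r v,
              [/\ {in u, forall a, r a x}, {in u, forall a, r a y} & {in u, forall a, r a z}],
              [/\ {in v, forall b, r x b}, {in v, forall b, r y b} & {in v, forall b, r z b}] &
              {in u & v, forall a b, r a b} /\ [/\ r x y, r x z & r y z]]
          (pairwise r (u ++ [:: x; y; z] ++ v)).
Proof.
rewrite pairwise_cat pairwise_cons /= !allrel_consr.
apply: (iffP and3P).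
  case=> /and4P[ux uy uz /allrelP uv] pu /and3P[/and3P[xy xz xv] /andP[yz yv] /andP[zv pv]].
  split=> //; split=> //; first [exact/allP | exact: uv].
case=> pu pv [ux uy uz] [xv yv zv] [uv [xy xz yz]].
split; rewrite ?xy ?xz ?yz //=.
  by apply/and4P; split; first [exact/allP | exact/allrelP].
by rewrite pv !andbT; apply/and3P; split; exact/allP.
Qed.

Lemma eq_count_chain (c c' : nat -> nat) k s :
  {in s, forall a, (c' a < k) = (c a < k)} ->
  count (fun a => c' a < k) s = count (fun a => c a < k) s.
Proof. exact: eq_in_count. Qed.

(* If x and z are consecutive in a chain, then the move breaks it. Either y is
   free and replaces z, or y lies in a second chain, with which the tails are
   exchanged. *)
Lemma chains_KnuthRight k s u v x y z : x < y -> y < z ->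
  uniq (u ++ [:: x; z; y] ++ v) ->
  has_chains k s (u ++ [:: x; z; y] ++ v) -> has_chains k s (u ++ [:: z; x; y] ++ v).
Proof.
move=> lt_xy lt_yz Uw [c /pairwise_cat3[pu pv [ux uz uy] [xv zv yv] [uv [xz xy zy]]]] ->.
have [/andP[/eqP cxz ck]|xz_free] := boolP ((c x == c z) && (c x < k)); last first.
  (* Unless [x] and [z] share a chain, the old colouring still serves. *)
  exists c; last by rewrite !count_cat /=; congr addn; rewrite addnCA.
  apply/pairwise_cat3; split=> //; split=> //; split=> //; apply/chain_relP => eq_c lt_c.
  by rewrite -eq_c lt_c eqxx in xz_free.
(* Before the move [z] precedes the smaller letter [y], so these two cannot share a chain. *)
rewrite cxz in ck; have neq_yz : c z != c y.
  by apply/eqP => eq_c; have := chain_relP zy eq_c ck; rewrite ltnNge ltnW.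
have zDy : z != y by rewrite gtn_eqF.
have xDy : x != y by rewrite ltn_eqF.
have xDz : x != z by rewrite ltn_eqF // (ltn_trans lt_xy).
have uN a : a \in u -> [/\ a \notin v, a != x, a != y & a != z].
  move=> ua; move: Uw; rewrite cat_uniq => /and3P[_ /hasPn/(_ a)/contraL/(_ ua) + _].
  by rewrite mem_cat !inE !negb_or -!andbA => /and4P[-> -> -> ->].
have vN a : a \in v -> [/\ a != x, a != y & a != z].
  move=> va; move: Uw; rewrite catA cat_uniq => /and3P[_ /hasPn/(_ a va) + _].
  by rewrite mem_cat !inE !negb_or => /andP[_ /and3P[-> -> ->]].
have [cy|cy] := leqP k (c y).
  (* Here [y] is free: it takes the place of [z], and the colour [k] sets [z] free. *)
  pose c' a := if a == y then c z else if a == z then k else c a.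
  have c'x : c' x = c z by rewrite /c' (negPf xDy) (negPf xDz).
  have c'y : c' y = c z by rewrite /c' eqxx.
  have c'z : c' z = k by rewrite /c' eqxx (negPf zDy).
  have c'u a : a \in u -> c' a = c a by case/uN=> _ _ /negPf ya /negPf za; rewrite /c' ya za.
  have c'v a : a \in v -> c' a = c a by case/vN=> _ /negPf ya /negPf za; rewrite /c' ya za.
  exists c'.
    apply/pairwise_cat3; split.
    - by apply: (sub_in_pairwise _ (allss u)) pu => a b ua ub; rewrite /chain_rel !c'u.
    - by apply: (sub_in_pairwise _ (allss v)) pv => a b va vb; rewrite /chain_rel !c'v.
    - have a_x a : a \in u -> c a = c z -> a < x.
        by move=> ua ca; apply: (chain_relP (ux a ua)); rewrite ca.
      split=> a ua; apply/chain_relP; rewrite ?c'x ?c'y ?c'z c'u // => ca.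
      + by rewrite ca ltnn.
      + by move=> _; apply: a_x.
      + by move=> _; apply: ltn_trans (a_x a ua ca) lt_xy.
    - have z_b b : b \in v -> c z = c b -> z < b.
        by move=> vb cb; apply: (chain_relP (zv b vb)).
      split=> b vb; apply/chain_relP; rewrite ?c'x ?c'y ?c'z c'v // => cb.
      + by rewrite ltnn.
      + by move=> _; apply: ltn_trans (ltn_trans lt_xy lt_yz) (z_b b vb cb).
      + by move=> _; apply: ltn_trans lt_yz (z_b b vb cb).
    - split; first by move=> a b ua vb; have := uv a b ua vb; rewrite /chain_rel c'u ?c'v.
      by split; apply/chain_relP; rewrite ?c'x ?c'y ?c'z ?ltnn.
  rewrite !count_cat /= c'x c'y c'z cxz ltnn ck (ltnNge (c y)) cy /=.
  by rewrite !(eq_count_chain (c := c) (c' := c')) => [|a /c'v-> //|a /c'u-> //].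
(* Now one chain is to run through [x], [y] and the old tail of [y], the other through [z] and the
   old tail of [z]. So the two colours are exchanged on [v]. *)
pose sw e := if e == c z then c y else if e == c y then c z else e.
have sw_z : sw (c z) = c y by rewrite /sw eqxx.
have sw_y : sw (c y) = c z by rewrite /sw [c y == _]eq_sym (negPf neq_yz) eqxx.
have swK : involutive sw.
  move=> e; rewrite {2}/sw; case: eqP => [->|ne_z]; first exact: sw_y.
  case: eqP => [->|ne_y]; first exact: sw_z.
  by rewrite /sw; case: eqP => // _; case: eqP.
have sw_lt e : (sw e < k) = (e < k).
  by rewrite /sw; case: eqP => [->|_]; [rewrite cy ck | case: eqP => [->|//]; rewrite ck cy].
pose c' a := if a == z then c y else if a == y then c z else if a \in v then sw (c a) else c a.
have c'x : c' x = c z.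
  rewrite /c' (negPf xDy) (negPf xDz) cxz; case: ifP => // /vN[].
  by rewrite eqxx.
have c'y : c' y = c z by rewrite /c' eqxx eq_sym (negPf zDy).
have c'z : c' z = c y by rewrite /c' eqxx.
have c'u a : a \in u -> c' a = c a.
  by case/uN=> /negPf va _ /negPf ya /negPf za; rewrite /c' ya za va.
have c'v a : a \in v -> c' a = sw (c a).
  by move=> va; case/vN: (va) => _ /negPf ya /negPf za; rewrite /c' ya za va.
have a_x a : a \in u -> c a = c z -> a < x.
  by move=> ua ca; apply: (chain_relP (ux a ua)); rewrite ca.
have a_y a : a \in u -> c a = c y -> a < y.
  by move=> ua ca; apply: (chain_relP (uy a ua)); rewrite ca.
have y_b b : b \in v -> c y = c b -> y < b by move=> vb cb; apply: (chain_relP (yv b vb)).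
have z_b b : b \in v -> c z = c b -> z < b by move=> vb cb; apply: (chain_relP (zv b vb)).
exists c'.
  apply/pairwise_cat3; split.
  - by apply: (sub_in_pairwise _ (allss u)) pu => a b ua ub; rewrite /chain_rel !c'u.
  - apply: (sub_in_pairwise _ (allss v)) pv => a b va vb.
    by rewrite /chain_rel !c'v // (inj_eq (inv_inj swK)) sw_lt.
  - split=> a ua; apply/chain_relP; rewrite ?c'x ?c'y ?c'z c'u // => ca _.
    + exact: ltn_trans (a_y a ua ca) lt_yz.
    + exact: a_x.
    + exact: ltn_trans (a_x a ua ca) lt_xy.
  - split=> b vb; apply/chain_relP; rewrite ?c'x ?c'y ?c'z c'v // => /(congr1 sw).
    + by rewrite swK sw_y => cb _; apply: z_b.
    + by rewrite swK sw_z => cb _; apply: ltn_trans lt_xy (y_b b vb cb).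
    + by rewrite swK sw_z => cb _; apply: y_b.
  - split; last first.
      split; apply/chain_relP; rewrite ?c'x ?c'y ?c'z //.
        by move=> /esym/eqP; rewrite (negPf neq_yz).
      by move=> /esym/eqP; rewrite (negPf neq_yz).
    move=> a b ua vb; apply/chain_relP; rewrite c'u ?c'v // => cab lt_ca.
    have {cab} cb : c b = sw (c a) by rewrite cab swK.
    have [ca|ne_z] := eqVneq (c a) (c z).
      apply: ltn_trans (ltn_trans (a_x a ua ca) lt_xy) (y_b b vb _).
      by rewrite cb ca sw_z.
    have [ca|ne_y] := eqVneq (c a) (c y).
      apply: ltn_trans (ltn_trans (a_y a ua ca) lt_yz) (z_b b vb _).
      by rewrite cb ca sw_y.
    apply: (chain_relP (uv a b ua vb)) => //.
    by rewrite cb /sw (negPf ne_z) (negPf ne_y).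
rewrite !count_cat /= c'x c'y c'z cxz cy ck /=.
rewrite !(eq_count_chain (c := c) (c' := c')) => [//|a va|a /c'u-> //].
by rewrite c'v.
Qed.

(** This move only turns the descent [z], [x] into an ascent, which breaks no chain. *)
Lemma chains_KnuthLeft k s u v x y z : x < z ->
  has_chains k s (u ++ [:: y; z; x] ++ v) -> has_chains k s (u ++ [:: y; x; z] ++ v).
Proof.
move=> lt_xz [c /pairwise_cat3[pu pv [uy uz ux] [yv zv xv] [uv [yz yx zx]]]] ->.
exists c; last by rewrite !count_cat /=; lia.
by apply/pairwise_cat3; do 2![split=> //]; rewrite /chain_rel lt_xz implybT.
Qed.

Lemma knuth_chains k s u w : knuth u w -> uniq u -> has_chains k s u -> has_chains k s w.
Proof.
elim=> {u w} [//|v u w uv IHuv vw IHvw|u v x y z lt_xy lt_yz|u v x y z lt_xy lt_yz] Uu.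
- by move/(IHuv Uu); apply: IHvw; rewrite -(perm_uniq (knuth_perm uv)).
- exact/chains_KnuthLeft/(ltn_trans lt_xy).
- exact: chains_KnuthRight.
Qed.

(** * Row insertion as a sequence of Knuth moves on the reading word *)

Definition reading t : seq nat := flatten (rev t).

Lemma reading_cons r t : reading (r :: t) = reading t ++ r.
Proof. by rewrite /reading rev_cons flatten_rcons. Qed.

(** First half of a bump: the letter [x], appended to the row, moves left past the entries that
    follow the bumped letter [b]. *)
Lemma knuth_bubble_left b x s : x < b -> path ltn b s ->
  knuth (b :: rcons s x) [:: b, x & s].
Proof.
elim: s b => [|c s IHs] b lt_xb /=; first by move=> _; apply: KnuthRefl.
case/andP=> lt_bc path_s; apply: (KnuthTrans (v := [:: b, c, x & s])).
  by have := knuth_cat [:: b] [::] (IHs c (ltn_trans lt_xb lt_bc) path_s); rewrite !cats0.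
exact: (KnuthLeft [::] s lt_xb lt_bc).
Qed.

(** Second half of a bump: [b] moves left past the entries before it and so leaves the row at its
    front. *)
Lemma knuth_bubble_right s b x t : x < b -> sorted ltn (rcons s x) ->
  knuth (s ++ [:: b, x & t]) (b :: s ++ x :: t).
Proof.
elim/last_ind: s x t => [|s a IHs] x t lt_xb; first by move=> _; apply: KnuthRefl.
rewrite -cats1 cat_rcons sorted_cat_cons => /andP[sorted_s /andP[lt_ax _]].
apply: (KnuthTrans (v := s ++ [:: b, a, x & t])).
  by rewrite cat_rcons; apply: (KnuthRight s t lt_ax lt_xb).
by rewrite cat_rcons; apply: IHs => //; apply: ltn_trans lt_xb.
Qed.

Lemma sorted_ltn_rcons r x : sorted ltn (rcons r x) = sorted ltn r && all (gtn x) r.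
Proof. by rewrite !(sorted_pairwise ltn_trans) pairwise_rcons andbC. Qed.

Lemma bump_knuth r x (i := find (ltn x) r) :
    sorted ltn r -> x \notin r -> i < size r ->
  knuth (rcons r x) (nth 0 r i :: set_nth 0 r i x) /\ sorted ltn (set_nth 0 r i x).
Proof.
move=> sorted_r Nxr lt_i; have lt_xb : x < nth 0 r i by apply: nth_find; rewrite has_find.
have := sorted_r; rewrite set_nthE lt_i -{1 2}(cat_take_drop i r) (drop_nth 0 lt_i).
rewrite sorted_cat_cons => /andP[sorted_l path_b].
have sorted_x : sorted ltn (rcons (take i r) x).
  move: sorted_l; rewrite !sorted_ltn_rcons => /andP[-> _] /=.
  apply/allP => a a_r /=; rewrite ltn_neqAle andbC leqNgt; apply/andP; split.
    have lt_a : index a (take i r) < i.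
      by have := a_r; rewrite -index_mem size_take lt_i.
    have /= := before_find 0 lt_a; rewrite -(nth_take (n0 := i)) // nth_index // => ->.
    by [].
  by apply: contraNneq Nxr => <-; apply: mem_take a_r.
split; last first.
  rewrite sorted_cat_cons sorted_x /=; case: (drop _ _) path_b => //= c t /andP[lt_bc ->].
  by rewrite (ltn_trans lt_xb lt_bc).
rewrite rcons_cat rcons_cons;
  apply: (KnuthTrans (v := take i r ++ [:: nth 0 r i, x & drop i.+1 r])).
  by have := knuth_cat (take i r) [::] (knuth_bubble_left lt_xb path_b); rewrite !cats0.
exact: knuth_bubble_right.
Qed.

(** A bumped letter ends up in front of its row, hence directly behind the reading word of the rows
    below, where its own insertion begins. *)
Lemma insert_knuth t x : all (sorted ltn) t -> uniq (rcons (reading t) x) ->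
  knuth (rcons (reading t) x) (reading (insert t x).1) /\ all (sorted ltn) (insert t x).1.
Proof.
elim: t x => [|r t IHt] x /=; first by split=> //; apply: KnuthRefl.
case/andP=> sorted_r sorted_t; rewrite reading_cons rcons_cat.
rewrite cat_uniq rcons_uniq => /and4P[Ut /hasPn/= N_rt Nxr Ur].
have := insert_cons r t x => /= ->; case: ifP => [lt_i|ge_i] /=; last first.
  rewrite reading_cons; split; first exact: KnuthRefl.
  rewrite sorted_t sorted_ltn_rcons sorted_r /= andbT; apply/allP => a a_r /=.
  have : ~~ has (ltn x) r by rewrite has_find ge_i.
  move/hasPn/(_ a a_r); rewrite /= -leqNgt leq_eqVlt => /predU1P[eq_ax|//].
  by rewrite -eq_ax a_r in Nxr.
have [knuth_r ->] := bump_knuth sorted_r Nxr lt_i.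
have [|knuth_t ->] := IHt (nth 0 r (find (ltn x) r)) sorted_t.
  by rewrite rcons_uniq Ut andbT; apply: N_rt; rewrite mem_rcons inE mem_nth ?orbT.
split=> //; rewrite reading_cons.
have := knuth_cat (reading t) [::] knuth_r; rewrite !cats0 => /KnuthTrans; apply.
by rewrite -cat_rcons; apply: (knuth_cat [::]).
Qed.

Lemma RSK_knuth w : uniq w ->
  knuth w (reading (RSK w).1) /\ all (sorted ltn) (RSK w).1.
Proof.
rewrite /RSK; move: 0 => m.
suff foldl_knuth PQ : uniq (reading PQ.1 ++ w) -> all (sorted ltn) PQ.1 ->
    let P := (foldl RSK_step PQ (zip w (iota m (size w)))).1 in
    knuth (reading PQ.1 ++ w) (reading P) /\ all (sorted ltn) P.
  by move=> Uw; apply: (foldl_knuth ([::], [::])) Uw isT.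
elim: w m PQ => [|x w IHw] m [P Q] /=; first by rewrite cats0; split=> //; apply: KnuthRefl.
rewrite -cat_rcons => Uw sorted_P.
have [|kP sortedP'] := insert_knuth (x := x) sorted_P; first by move: Uw; rewrite cat_uniq =>
  /and3P[].
have := knuth_cat [::] w kP; rewrite /= => k_w.
have := IHw m.+1 (RSK_step (P, Q) (x, m)); rewrite /RSK_step /=.
move: k_w sortedP'; case: (insert P x) => P' k /= k_w sortedP' [|//|k_w' sorted_w'].
  by rewrite -(perm_uniq (knuth_perm k_w)).
by split=> //; apply: KnuthTrans k_w'.
Qed.

Lemma RSK_col_tableau w : col_tableau (RSK w).1.
Proof.
apply: (@RSK_ind (fun PQ => col_tableau PQ.1)) => // -[P Q] [x m] /(insert_col_tableau x).
by rewrite /RSK_step /=; case: (insert P x).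
Qed.

(** * Greene's inequalities for the shape *)

(** Pigeonhole: the letters counted have pairwise distinct colours. *)
Lemma count_rainbow k (c : nat -> nat) s :
    pairwise (fun a b => (c a == c b) && (c a < k) ==> false) s ->
  count (fun a => c a < k) s <= k.
Proof.
move=> rainbow_s; rewrite -size_filter -(size_map c) -[leqRHS](size_iota 0).
apply: uniq_leq_size => [|_ /mapP[a /[!mem_filter] /andP[lt_ck _] ->]].
  rewrite uniq_pairwise pairwise_map; have := filter_all (fun a => c a < k) s.
  have := subseq_pairwise (filter_subseq (fun a => c a < k) s) rainbow_s.
  move: (filter _ s) => {rainbow_s}s rainbow_s ck.
  by apply: (sub_in_pairwise _ ck) rainbow_s => a b; rewrite unfold_in => ak _ /=;
    rewrite ak andbT implybF.
by rewrite mem_iota.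
Qed.

Lemma pairwise_reading e t :
  pairwise e (reading t) -> pairwise (fun r r' => allrel e r' r) t.
Proof.
elim: t => //= r t IHt; rewrite reading_cons pairwise_cat => /and3P[/allrelP t_r /IHt -> _].
rewrite andbT; apply/allP => r' r't; apply/allrelP => a b ar' br; apply: t_r br.
by apply/flattenP; exists r'; rewrite ?mem_rev.
Qed.

Definition column j t := [seq nth 0 r j | r <- t & j < size r].

Lemma count_columns P n t : {in t, forall r, size r <= n} ->
  count P (reading t) = \sum_(j < n) count P (column j t).
Proof.
elim: t => [|r t IHt] le_n; first by rewrite big1 // => j _.
rewrite reading_cons count_cat IHt => [|s st]; last by rewrite le_n // inE st orbT.
rewrite -[in count P r](mkseq_nth 0 r) /mkseq count_map.
have -> : count (preim (nth 0 r) P) (iota 0 (size r)) =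
    \sum_(j < n) (j < size r) && P (nth 0 r j).
  rewrite -(subnK (le_n r (mem_head _ _))) addnC.
  rewrite big_split_ord /= [X in _ + X]big1 ?addn0 => [|j _]; last by rewrite ltnNge leq_addr.
  rewrite -sum1_count big_mkcond /= -(big_mkord xpredT (fun j =>
    nat_of_bool ((j < size r) && P (nth 0 r j)))).
  rewrite /index_iota subn0 big_seq [RHS]big_seq; apply: eq_bigr => j.
  by rewrite mem_iota /= add0n => ->.
rewrite -big_split; apply: eq_bigr => j _ /=; rewrite /column /= addnC.
by case: (j < size r).
Qed.

(** The parts exceeding [j] come first, so cutting after [k] parts keeps either all of them or
    [k]. *)
Lemma part_count_take k j l : sorted geq l ->
  minn k (count (ltn j) l) <= count (ltn j) (take k l).
Proof.
rewrite (sorted_pairwise (rev_trans leq_trans)); elim: l k => [|x l IHl] [|k] //=;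
  first by rewrite min0n.
case/andP=> /allP/= le_x sorted_l; have := IHl k sorted_l; case: (ltnP j x) => [|ge_x];
  first by lia.
suff -> : count (ltn j) l = 0 by rewrite minn0.
by apply/eqP; rewrite -leqn0 leqNgt -has_count; apply/hasPn => y /le_x /=; lia.
Qed.

Lemma sum_count_ltn n l : {in l, forall x, x <= n} -> \sum_(j < n) count (ltn j) l = sumn l.
Proof.
elim: l => [|x l IHl] le_n /=; first by rewrite big1.
rewrite big_split /= IHl => [|y yl]; last by rewrite le_n // inE yl orbT.
congr addn; rewrite -(subnK (le_n x (mem_head _ _))) addnC big_split_ord /=.
rewrite [X in _ + X]big1 ?addn0 => [|j _]; last by rewrite ltnNge leq_addr.
by under eq_bigr do rewrite ltn_ord; rewrite sum1_card card_ord.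
Qed.

(** In the reading word each column is a decreasing subsequence, so it meets every chain at most
    once. It thus contains at most [k] coloured letters, and the sum over the columns is bounded by
    the number of boxes in the first [k] rows. *)
Lemma chains_le_rows k s t : col_tableau t -> has_chains k s (reading t) ->
  s <= sumn (take k (shape t)).
Proof.
move=> tab_t [c chains_t ->]; have [n le_n] : exists n, {in t, forall r, size r <= n}.
  by exists (\max_(r <- t) size r) => r rt; apply: leq_bigmax_seq.
rewrite (count_columns _ le_n) -(sum_count_ltn (n := n)) => [|x /mem_take/mapP[r /le_n + ->]//].
apply: leq_sum => j _; apply: leq_trans (part_count_take _ _ _); last first.
  by case/andP: (col_tableau_shape tab_t).
rewrite leq_min; apply/andP; split; last first.
  apply: leq_trans (count_size _ _) _; rewrite size_map size_filter /shape count_map.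
  by apply/eq_leq/eq_count.
apply: count_rainbow; rewrite /column pairwise_map; case/andP: tab_t => strict_t _.
have column_strict_trans : transitive column_strict.
  move=> r2 r1 r3 /column_strictP[sz12 lt12] /column_strictP[sz23 lt23].
  apply/column_strictP; split=> [|i lt_i]; first exact: leq_trans sz12.
  exact: ltn_trans (lt12 i (leq_trans lt_i sz23)) (lt23 i lt_i).
move: strict_t; rewrite (sorted_pairwise column_strict_trans) => strict_t.
have both_t : pairwise (fun r r' => column_strict r r' && allrel (chain_rel k c) r' r) t.
  by rewrite pairwise_relI strict_t pairwise_reading.
have /= := subseq_pairwise (filter_subseq (fun r => j < size r) t) both_t.
apply: sub_in_pairwise (filter_all _ t) => r r'; rewrite !unfold_in => jr jr' /=.
case/andP=> /column_strictP[_ /(_ j jr') lt_j] /allrelP/(_ _ _ (mem_nth 0 jr') (mem_nth 0 jr)).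
by rewrite /chain_rel; move: (nth 0 r j) (nth 0 r' j) lt_j => a b lt_ab; lia.
Qed.

Lemma pairwise_rev (T : Type) (e : rel T) s :
  pairwise e (rev s) = pairwise (fun a b => e b a) s.
Proof. by elim: s => //= a s IHs; rewrite rev_cons pairwise_rcons all_rev IHs. Qed.

(** Dually, a row read backwards is decreasing and contains at most [k] coloured letters. *)
Lemma chains_le_columns k s t : all (sorted ltn) t -> has_chains k s (rev (reading t)) ->
  s <= sumn (map (minn k) (shape t)).
Proof.
move=> sorted_t [c chains_t ->]; rewrite count_rev.
elim: t sorted_t chains_t => //= r t IHt /andP[sorted_r sorted_t].
rewrite reading_cons rev_cat pairwise_cat => /and3P[_ chains_r /(IHt sorted_t)].
rewrite count_cat addnC; apply: leq_add; rewrite leq_min count_size andbT.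
apply: count_rainbow; move: chains_r sorted_r; rewrite pairwise_rev (sorted_pairwise ltn_trans).
move=> chains_r sorted_r; have : pairwise (fun a b => (a < b) && chain_rel k c b a) r.
  by rewrite pairwise_relI sorted_r.
by apply: sub_pairwise => a b; rewrite /chain_rel /=; lia.
Qed.

(** One inequality of Greene's theorem: Knuth moves carry the chains over to the reading word of the
    insertion tableau, where they can be counted. *)
Lemma RSK_increasing k s w : uniq w -> has_chains k s w ->
  s <= sumn (take k (shape (RSK w).1)).
Proof.
move=> Uw chains_w; have [k_w _] := RSK_knuth Uw.
exact: chains_le_rows (RSK_col_tableau w) (knuth_chains k_w Uw chains_w).
Qed.

Lemma RSK_decreasing k s w : uniq w -> has_chains k s (rev w) ->
  s <= sumn (map (minn k) (shape (RSK w).1)).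
Proof.
move=> Uw chains_w; have [k_w sorted_w] := RSK_knuth Uw.
apply: chains_le_columns sorted_w (knuth_chains (knuth_rev k_w) _ chains_w).
by rewrite rev_uniq.
Qed.

Lemma size_RSK w : uniq w -> sumn (shape (RSK w).1) = size w.
Proof.
case/RSK_knuth=> /knuth_perm/perm_size -> _.
by rewrite /reading size_flatten /shape map_rev sumn_rev.
Qed.

(** * Words labelled by the boxes of a diagram *)

Fixpoint boxes (l : seq nat) : seq (nat * nat) :=
  if l is x :: l' then
    [seq (0, j) | j <- iota 0 x] ++ [seq (b.1.+1, b.2) | b <- boxes l']
  else [::].

Lemma mem_boxes l i j : ((i, j) \in boxes l) = (j < nth 0 l i).
Proof.
elim: l i => [|x l IHl] i /=; first by rewrite nth_nil.
rewrite mem_cat; case: i => [|i] /=.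
  rewrite mem_map => [|j1 j2 [->] //]; rewrite mem_iota add0n orb_idr //.
  by case/mapP=> b _.
rewrite -IHl; apply/orP/idP => [[/mapP[j' _ //]|/mapP[[i' j'] b_l [-> ->]] //]|b_l]; right.
by apply/mapP; exists (i, j).
Qed.

Lemma boxes_uniq l : uniq (boxes l).
Proof.
elim: l => //= x l IHl; rewrite cat_uniq !map_inj_uniq ?iota_uniq ?IHl ?andbT /=.
- by apply/hasPn => _ /mapP[b _ ->]; apply/mapP => -[].
- by case=> i j [i' j'] /= [-> ->].
- by move=> j j' [].
Qed.

Lemma size_boxes l : size (boxes l) = sumn l.
Proof. by elim: l => //= x l IHl; rewrite size_cat !size_map size_iota IHl. Qed.

Lemma count_boxes_rows k l : count (fun b => b.1 < k) (boxes l) = sumn (take k l).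
Proof.
elim: l k => [|x l IHl] k //=; rewrite count_cat !count_map.
case: k => [|k] /=; first by rewrite !(@eq_count _ _ pred0) ?count_pred0.
by rewrite -IHl (@eq_count _ _ predT) // count_predT size_iota.
Qed.

Lemma count_boxes_columns k l : count (fun b => b.2 < k) (boxes l) = sumn (map (minn k) l).
Proof.
elim: l => [|x l IHl] //=; rewrite count_cat !count_map -IHl; congr addn.
have [le_kx|lt_xk] := leqP k x; last first.
  rewrite -[RHS](size_iota 0); apply/eqP; rewrite -all_count; apply/allP => j.
  by rewrite mem_iota /=; lia.
rewrite -(subnKC le_kx) iotaD count_cat (_ : count _ (iota 0 k) = k).
  rewrite (_ : count _ _ = 0) ?addn0 //; apply/eqP; rewrite -leqn0 leqNgt -has_count.
  by apply/hasPn => j; rewrite mem_iota /=; lia.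
rewrite -[RHS](size_iota 0 k); apply/eqP; rewrite -all_count; apply/allP => j.
by rewrite mem_iota /=; lia.
Qed.

(** For equal sums, conjugation reverses dominance, so the two families of inequalities bound [l]
    from opposite sides. *)
Lemma eq_part l m : is_part l -> is_part m -> sumn l = sumn m ->
    (forall k, sumn (take k m) <= sumn (take k l)) ->
    (forall k, sumn (map (minn k) m) <= sumn (map (minn k) l)) ->
  l = m.
Proof.
elim: l m => [|a l IHl] [|b m] //.
- by move=> _ /andP[_]; rewrite inE => /norP[] /=; lia.
- by move=> /andP[_]; rewrite inE => /norP[] /=; lia.
rewrite /is_part /= !inE !negb_or.
case/andP=> path_l /andP[_ l0] /andP[path_m /andP[b0 m0]] eq_sum le_rows le_cols.
have map_minn_id k s : {in s, forall x, x <= k} -> map (minn k) s = s.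
  by move=> le_k; rewrite -[RHS]map_id; apply/eq_in_map => x /le_k; lia.
have sumn_minn_le k s : sumn (map (minn k) s) <= sumn s.
  by elim: s => //= x s IHs; lia.
have le_ba : b <= a by have := le_rows 1; rewrite /= !take0 /= !addn0.
have eq_ab : a = b.
  (* Capping at [b] does not change [b :: m]; as the sums agree, it cannot lower [a] either. *)
  have := le_cols b; rewrite /= map_minn_id; first by have := sumn_minn_le b l; lia.
  by apply/allP; exact: (order_path_min (rev_trans leq_trans) path_m).
subst b; congr cons; apply: IHl.
- by rewrite /is_part (path_sorted path_l).
- by rewrite /is_part (path_sorted path_m).
- by lia.
- by move=> k; have := le_rows k.+1; rewrite /=; lia.
- by move=> k; have := le_cols k; rewrite /=; lia.
Qed.

Definition filling (v : nat * nat -> nat) bs :=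
  pairwise (fun b b' => ((b.1 == b'.1) ==> (v b < v b')) &&
                        ((b.2 == b'.2) ==> (v b' < v b))) bs.

(** The first [k] rows of [l] serve as increasing chains and the first [k] columns as decreasing
    ones, so Greene's inequalities give the hypotheses of [eq_part]. *)
Lemma RSK_filling (l : seq nat) v bs : is_part l -> perm_eq bs (boxes l) ->
  {in bs &, injective v} -> filling v bs -> shape (RSK (map v bs)).1 = l.
Proof.
move=> part_l perm_bs v_inj fill_bs.
have Uv : uniq (map v bs) by rewrite map_inj_in_uniq // (perm_uniq perm_bs) boxes_uniq.
pose box a := nth (0, 0) bs (index a (map v bs)).
have boxK : {in bs, forall b, box (v b) = b} by move=> b; apply: nth_index_map.
apply: eq_part => //; first exact: RSK_shapeP.
- by rewrite size_RSK // size_map (perm_size perm_bs) size_boxes.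
- move=> k; rewrite -count_boxes_rows -(seq.permP perm_bs); apply: RSK_increasing => //.
  exists (fun a => (box a).1).
    rewrite pairwise_map; apply: (sub_in_pairwise _ (allss bs)) fill_bs => b b' bs_b bs_b' /=.
    by rewrite /chain_rel !boxK // => /andP[/implyP lt_v _]; apply/implyP => /andP[/lt_v].
  by rewrite count_map; apply: eq_in_count => b bs_b /=; rewrite boxK.
- move=> k; rewrite -count_boxes_columns -(seq.permP perm_bs); apply: RSK_decreasing => //.
  exists (fun a => (box a).2).
    rewrite pairwise_rev pairwise_map.
    apply: (sub_in_pairwise _ (allss bs)) fill_bs => b b' bs_b bs_b' /=.
    by rewrite /chain_rel !boxK // [b'.2 == _]eq_sym => /andP[_ /implyP lt_v]; apply/implyP =>
      /andP[/lt_v].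
  by rewrite count_rev count_map; apply: eq_in_count => b bs_b /=; rewrite boxK.
Qed.

(** * Standardization of words, and words read off from lattice points *)

Definition rank (s : seq nat) a := count (gtn a) s.

Lemma ltn_rank s a b : a \in s -> b \in s -> (rank s a < rank s b) = (a < b).
Proof.
have le_rank c d : c <= d -> rank s c <= rank s d.
  by move=> le_cd; apply: sub_count => e /= /leq_trans; apply.
have lt_rank c d : c \in s -> c < d -> rank s c < rank s d.
  move=> sc lt_cd; have -> : rank s d = rank s c + count (fun e => c <= e < d) s.
    rewrite /rank -(count_predUI (gtn c)) [X in _ + X](@eq_count _ _ pred0) ?count_pred0 ?addn0.
      by apply: eq_count => e /=; lia.
    by move=> e /=; lia.
  rewrite -[ltnLHS]addn0 ltn_add2l -has_count; apply/hasP; exists c => //.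
  by rewrite leqnn.
move=> sa sb; case: (ltnP a b) => [/lt_rank-> //|/le_rank].
by rewrite leqNgt => /negPf.
Qed.

Lemma standardize s : uniq s -> exists p, word p = map (rank s) s.
Proof.
move=> Us; have lt_r (i : 'I_(size s)) : rank s (nth 0 s i) < size s.
  rewrite /rank -[ltnRHS](count_predC (gtn (nth 0 s i))) -[ltnLHS]addn0 ltn_add2l -has_count.
  by apply/hasP; exists (nth 0 s i); rewrite ?mem_nth //= ltnn.
have r_inj : injective (fun i => Ordinal (lt_r i)).
  move=> i j /(congr1 val)/= eq_r; apply/val_inj/eqP;
    rewrite -(nth_uniq 0 (ltn_ord i) (ltn_ord j) Us).
  have := ltn_rank (mem_nth 0 (ltn_ord i)) (mem_nth 0 (ltn_ord j)).
  have := ltn_rank (mem_nth 0 (ltn_ord j)) (mem_nth 0 (ltn_ord i)).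
  rewrite eq_r ltnn => /esym/negbT + /esym/negbT; rewrite -!leqNgt eqn_leq.
  by move=> -> ->.
exists (existT _ (size s) (perm r_inj)); rewrite /word /Defs.pval /=.
under eq_map do rewrite permE /=.
by rewrite -[X in _ = map _ X](mkseq_nth 0 s) -[RHS]map_comp -val_enum_ord -[RHS]map_comp.
Qed.

Lemma nth_word (p : permutation) (i : 'I_(plength p)) : nth 0 (word p) i = val (Defs.pval p i).
Proof. by rewrite (nth_map i) ?size_enum_ord // nth_ord_enum. Qed.

Lemma size_word (p : permutation) : size (word p) = plength p.
Proof. by rewrite size_map size_enum_ord. Qed.

Lemma subseq_pattern s s' (p q : permutation) : uniq s -> subseq s' s ->
  word p = map (rank s') s' -> word q = map (rank s) s -> pattern p q.
Proof.
move=> Us sub_s word_p word_q.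
have size_p : plength p = size s' by rewrite -size_word word_p size_map.
have size_q : plength q = size s by rewrite -size_word word_q size_map.
have lt_p (i : 'I_(plength p)) : i < size s' by rewrite -size_p.
have s_nth (i : 'I_(plength p)) : nth 0 s' i \in s by rewrite (mem_subseq sub_s) ?mem_nth.
have lt_f (i : 'I_(plength p)) : index (nth 0 s' i) s < plength q.
  by rewrite size_q index_mem.
have incr_index : pairwise (fun a b => index a s < index b s) s.
  by apply/(pairwiseP 0) => i j lt_i lt_j lt_ij; rewrite !index_uniq.
exists (fun i => Ordinal (lt_f i)); split=> i j /=.
  by move: (subseq_pairwise sub_s incr_index) => /(pairwiseP 0)/(_ i j (lt_p i) (lt_p j)).
rewrite -!nth_word word_p word_q !(nth_map 0) ?index_mem //= !nth_index //.
by rewrite !ltn_rank ?mem_nth.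
Qed.


(* Points of a row of the lattice are read as increasing and those of a column as
   decreasing sequences: the lattice is turned slightly anticlockwise. *)
Definition inc (P Q : nat * nat) := (P.1 < Q.1) && (P.2 <= Q.2).
Definition dec (P Q : nat * nat) := (P.1 <= Q.1) && (Q.2 < P.2).

(** The disjunctions leave the order within a row or column open, because the lattice lines are
    going to be permuted. *)
Definition placement (pt : nat * nat -> nat * nat) (l : seq nat) :=
  forall b b', b \in boxes l -> b' \in boxes l -> b != b' ->
    (b.1 = b'.1 -> inc (pt b) (pt b') || inc (pt b') (pt b)) /\
    (b.2 = b'.2 -> dec (pt b) (pt b') || dec (pt b') (pt b)).

(** Points are read by abscissa, and from top to bottom within a vertical line; letters grow with
    the ordinate, and from left to right within a horizontal line. This is the slight turn of the
    lattice, with [K] larger than all coordinates. *)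
Definition position K (P : nat * nat) := P.1 * K + (K - P.2).
Definition value K (P : nat * nat) := P.2 * K + P.1.
Definition in_square K : {pred nat * nat} := [pred P | (P.1 < K) && (P.2 < K)].

Lemma position_inj K : {in in_square K &, injective (position K)}.
Proof.
move=> [x y] [x' y']; rewrite !inE /position /= => /andP[lt_x lt_y] /andP[lt_x' lt_y'] eq_pos.
have eq_x : x = x' by nia.
by subst x'; congr pair; lia.
Qed.

Lemma value_inj K : {in in_square K &, injective (value K)}.
Proof.
move=> [x y] [x' y']; rewrite !inE /value /= => /andP[lt_x lt_y] /andP[lt_x' lt_y'] eq_val.
have eq_y : y = y' by nia.
by subst y'; congr pair; lia.
Qed.

Lemma inc_lt K P Q : P \in in_square K -> Q \in in_square K -> inc P Q ->
  position K P < position K Q /\ value K P < value K Q.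
Proof.
case: P Q => [x y] [x' y']; rewrite !inE /inc /position /value /=.
by move=> /andP[lt_x lt_y] /andP[lt_x' lt_y'] /andP[lt_xx' le_yy']; split; nia.
Qed.

Lemma dec_lt K P Q : P \in in_square K -> Q \in in_square K -> dec P Q ->
  position K P < position K Q /\ value K Q < value K P.
Proof.
case: P Q => [x y] [x' y']; rewrite !inE /dec /position /value /=.
by move=> /andP[lt_x lt_y] /andP[lt_x' lt_y'] /andP[le_xx' lt_yy']; split; nia.
Qed.

Section Reading.

Variables (K : nat) (l : seq nat) (pt : nat * nat -> nat * nat).
Hypotheses (part_l : is_part l) (pt_K : {in boxes l, forall b, pt b \in in_square K}).
Hypotheses (pt_inj : {in boxes l &, injective pt}) (place_pt : placement pt l).

Let before b b' := position K (pt b) <= position K (pt b').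
Let bs := sort before (boxes l).

Definition points := map pt bs.

Let bsE : bs =i boxes l.
Proof. exact: mem_sort. Qed.

Lemma mem_points : points =i map pt (boxes l).
Proof. by apply: eq_mem_map; apply: bsE. Qed.

Let pos_inj : {in boxes l &, injective (fun b => position K (pt b))}.
Proof. by move=> b b' lb lb' /position_inj/pt_inj-> //; apply: pt_K. Qed.

Let bs_sorted : sorted (fun b b' => position K (pt b) < position K (pt b')) bs.
Proof.
have : sorted ltn (map (position K \o pt) bs); last by rewrite sorted_map.
rewrite ltn_sorted_uniq_leq.
rewrite map_inj_in_uniq ?sort_uniq ?boxes_uniq.
  by rewrite sorted_map sort_sorted // => b b'; apply: leq_total.
by move=> b b'; rewrite !bsE; apply: pos_inj.
Qed.

Lemma points_sorted : sorted (fun P Q => position K P < position K Q) points.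
Proof. by rewrite /points sorted_map. Qed.

Lemma value_points_inj : {in points &, injective (value K)}.
Proof.
move=> P Q; rewrite !mem_points => /mapP[b lb ->] /mapP[b' lb' ->].
by apply: value_inj; apply: pt_K.
Qed.

(** The map [f] is meant to be the [rank] of a standardization; the filling stays valid because only
    the order of the letters matters. *)
Lemma RSK_points f : {in map (value K) points &, {mono f : a b / a < b}} ->
  shape (RSK (map f (map (value K) points))).1 = l.
Proof.
move=> f_mono; rewrite -!map_comp.
have mem_val b : b \in boxes l -> value K (pt b) \in map (value K) points.
  by move=> lb; rewrite map_f // mem_points map_f.
have f_lt b b' : b \in boxes l -> b' \in boxes l ->
    (f (value K (pt b)) < f (value K (pt b'))) = (value K (pt b) < value K (pt b')).
  by move=> lb lb'; rewrite f_mono ?mem_val.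
apply: RSK_filling => //; first by rewrite perm_sort.
  move=> b b'; rewrite !bsE => lb lb' /= eq_f; apply: pt_inj => //.
  apply: (@value_inj K); rewrite ?pt_K //.
  have := f_lt b b' lb lb'; have := f_lt b' b lb' lb; rewrite eq_f ltnn; lia.
have := bs_sorted; rewrite (sorted_pairwise (fun b2 b1 b3 => @ltn_trans _ _ _)).
apply: (sub_in_pairwise _ (allss bs)) => b b'; rewrite !bsE => lb lb' lt_pos /=.
have neq_b : b != b' by apply: contraTneq lt_pos => ->; rewrite ltnn.
have [row_bb' col_bb'] := place_pt lb lb' neq_b; rewrite !f_lt //.
apply/andP; split; apply/implyP => /eqP.
  by move/row_bb'=> /orP[/(inc_lt (pt_K lb) (pt_K lb'))|/(inc_lt (pt_K lb') (pt_K lb))]; lia.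
by move/col_bb'=> /orP[/(dec_lt (pt_K lb) (pt_K lb'))|/(dec_lt (pt_K lb') (pt_K lb))]; lia.
Qed.

End Reading.

(** Both words are read off by the same rule, so fewer points give a subsequence. *)
Lemma pattern_points (l m : intpart) K pl pm :
    {in boxes m, forall b, pm b \in in_square K} ->
    {in boxes l, forall b, pl b \in map pm (boxes m)} ->
    {in boxes l &, injective pl} -> {in boxes m &, injective pm} ->
    placement pl l -> placement pm m ->
  exists p q, [/\ sh p = l, sh q = m & pattern p q].
Proof.
move=> pm_K pl_pm pl_inj pm_inj place_l place_m.
have pl_K : {in boxes l, forall b, pl b \in in_square K}.
  by move=> b /pl_pm/mapP[b' mb' ->]; apply: pm_K.
have Uval (n : intpart) pn : {in boxes n, forall b, pn b \in in_square K} ->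
    {in boxes n &, injective pn} -> uniq (map (value K) (points K n pn)).
  move=> pn_K pn_inj; rewrite map_inj_in_uniq; last exact: value_points_inj.
  by rewrite map_inj_in_uniq ?sort_uniq ?boxes_uniq // => b b'; rewrite !mem_sort; apply: pn_inj.
have [p word_p] := standardize (Uval l pl pl_K pl_inj).
have [q word_q] := standardize (Uval m pm pm_K pm_inj).
exists p, q; split.
- apply: val_inj; rewrite /= word_p; apply: RSK_points => //; first exact: valP.
  by move=> a b; apply: ltn_rank.
- apply: val_inj; rewrite /= word_q; apply: RSK_points => //; first exact: valP.
  by move=> a b; apply: ltn_rank.
apply: subseq_pattern word_p word_q; first exact: Uval.
apply: map_subseq; rewrite (_ : points K l pl = filter (mem (points K l pl)) (points K m pm)).
  exact: filter_subseq.
(* A strictly sorted list is determined by its members. *)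
have pos_trans : transitive (fun P Q => position K P < position K Q).
  by move=> P2 P1 P3; apply: ltn_trans.
apply: (irr_sorted_eq pos_trans) => [P||| P].
- exact: ltnn.
- exact: points_sorted.
- by apply: sorted_filter => //; apply: points_sorted.
rewrite mem_filter /= andb_idr // !mem_points => /mapP[b lb ->].
exact: pl_pm.
Qed.

(** * Patterns with one letter less *)

Lemma sumn_take_nth k l : sumn (take k.+1 l) = sumn (take k l) + nth 0 l k.
Proof.
by elim: l k => [|x l IHl] [|k] //=; rewrite ?take0 ?addn0 // IHl addnA.
Qed.

Lemma part_nth l i j : is_part l -> i <= j -> nth 0 l j <= nth 0 l i.
Proof.
case/andP=> sorted_l _ le_ij; have [lt_j|ge_j] := ltnP j (size l); last by rewrite nth_default.
apply: (sorted_leq_nth (leT := geq) (rev_trans leq_trans) _ 0 sorted_l) => //.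
  exact: leqnn.
exact: leq_ltn_trans lt_j.
Qed.

(* Lattice lines are numbered from 0 to 2M, with M in the centre. The lines in
   order of decreasing length are M, M-1, M+1, M-2, M+2, and so on. *)
Definition coord M p := if odd p then M - uphalf p else M + p./2.
Definition coord_rank M u := if u < M then (M - u).*2.-1 else (u - M).*2.

Lemma coordK M p : p <= M.*2 -> coord_rank M (coord M p) = p /\ coord M p <= M.*2.
Proof.
rewrite /coord /coord_rank; have := odd_double_half p; rewrite uphalf_half.
by case: (odd p) => /= eq_p le_p; case: ltnP; lia.
Qed.

Lemma coord_rankK M u : u <= M.*2 -> coord M (coord_rank M u) = u /\ coord_rank M u <= M.*2.
Proof.
rewrite /coord_rank; case: ltnP => [lt_u|le_u] le_u2; rewrite /coord.
  have -> : (M - u).*2.-1 = (M - u.+1).*2.+1 by lia.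
  by rewrite uphalf_half /= odd_double /= uphalf_double; lia.
by rewrite odd_double doubleK; lia.
Qed.

Lemma odd_coord_rank M u : odd (coord_rank M u) = (u < M).
Proof.
rewrite /coord_rank; case: ltnP => [lt_u|_]; last exact: odd_double.
have -> : (M - u).*2.-1 = (M - u.+1).*2.+1 by lia.
by rewrite /= odd_double.
Qed.

(* The box in row u and column v belongs to l if the rank of u is at most 2M minus
   that of v, with equality only for u < M, where l has one box more than m; and to
   m under the same condition, with equality only for u >= M. So the lemma says that
   the gluing map sends boxes of l to boxes of m. *)
Lemma pinwheel M u v : u <= M.*2 -> v <= M.*2 ->
    coord_rank M u < M.*2 - coord_rank M v + (u < M) ->
  [/\ u + (M <= v) <= M.*2, v + (u < M) <= M.*2 &
      coord_rank M (u + (M <= v)) <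
        M.*2 - coord_rank M (v + (u < M)) + (M <= u + (M <= v))].
Proof.
rewrite /coord_rank => le_u le_v.
case: (ltnP u M) => [lt_u|ge_u]; case: (ltnP v M) => [lt_v|ge_v] /=; rewrite ?addn0 ?addn1.
- by move=> lt_uv; rewrite lt_u (leqNgt M u) lt_u; case: (ltnP v.+1 M) => /= lt_v1; split; lia.
- by move=> lt_uv; rewrite (ltnNge v.+1) (leqW ge_v) /=; case: (ltnP u.+1 M) => /= lt_u1;
  split; lia.
- by move=> lt_uv; rewrite (ltnNge u) ge_u lt_v /=; split; lia.
by move=> lt_uv; rewrite (ltnNge u.+1) (leqW ge_u) (ltnNge v) ge_v /=; split; lia.
Qed.

Section OneBox.

Variables l m : seq nat.
Hypotheses (part_l : is_part l) (part_m : is_part m).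

(** By [le_sums], [a k] as a number is the excess of [m] over [l] in the first [k] rows. *)
Let a k := sumn (take k l) < sumn (take k m).

Hypotheses (le_sums : forall k, sumn (take k l) <= sumn (take k m) <= (sumn (take k l)).+1).
Hypothesis (sumn_m : sumn m = (sumn l).+1).

Let N := maxn (size l) (size m).
Let changed i := a i != a i.+1.
Let I := filter changed (iota 0 N).
(* The columns J are those in which l and m differ. *)
Let h i := minn (nth 0 l i) (nth 0 m i).
Let J := map h I.
Let M := (size I)./2.

Let lm_a i : nth 0 m i + a i = nth 0 l i + a i.+1.
Proof.
rewrite /a; have := le_sums i; have := le_sums i.+1; rewrite !sumn_take_nth; lia.
Qed.

Let a_N k : N <= k -> a k.
Proof. by rewrite geq_max => /andP[le_l le_m]; rewrite /a !take_oversize // sumn_m. Qed.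

Let odd_changed n : odd (count changed (iota 0 n)) = a n.
Proof.
elim: n => [|n IHn]; first by rewrite /a /= !take0.
by rewrite -addn1 iotaD count_cat oddD IHn /= addn0 add0n addn1 /changed;
  case: (a n) (a n.+1) => [] [].
Qed.

(** As [a] starts with false and ends with true, it flips an odd number of times. *)
Let size_I : size I = M.*2.+1.
Proof.
have odd_I : odd (size I) by rewrite size_filter odd_changed a_N.
by rewrite -[LHS]odd_double_half odd_I.
Qed.

Let I_sorted : sorted ltn I.
Proof. by apply: sorted_filter; [exact: ltn_trans | exact: iota_ltn_sorted]. Qed.

Let mem_I i : (i \in I) = changed i.
Proof.
rewrite mem_filter mem_iota add0n /= andb_idr // /changed.
by case: (ltnP i N) => // le_i; rewrite !a_N // leqW.
Qed.

(** Exactly [p] flips precede this row; hence the changed rows alternate between an extra box of [m]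
    and one of [l]. *)
Let a_nth p : p < size I -> a (nth 0 I p) = odd p.
Proof.
move=> lt_p; rewrite -odd_changed; congr odd; set i := nth 0 I p.
have Ii : i \in I by apply: mem_nth.
have lt_i : i < N by move: Ii; rewrite mem_filter mem_iota => /andP[].
have U_I : uniq I := sorted_uniq ltn_trans ltnn I_sorted.
rewrite -size_filter -(index_uniq 0 lt_p U_I) -/i.
have -> : I = filter changed (iota 0 i) ++ i :: filter changed (iota i.+1 (N - i.+1)).
  have ci : changed i by rewrite -mem_I.
  rewrite /I (_ : iota 0 N = iota 0 i ++ i :: iota i.+1 (N - i.+1)) ?filter_cat /= ?ci //.
  by rewrite -[in LHS](subnKC (ltnW lt_i)) iotaD add0n -(subnSK lt_i).
rewrite index_cat mem_filter mem_iota add0n ltnn !andbF /= eqxx addn0.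
by [].
Qed.

Let lm_I p : p < size I ->
  nth 0 m (nth 0 I p) = nth 0 J p + ~~ odd p /\ nth 0 l (nth 0 I p) = nth 0 J p + odd p.
Proof.
move=> lt_p; have := mem_nth 0 lt_p; rewrite mem_I /changed /J (nth_map 0) // /h.
by have := lm_a (nth 0 I p); rewrite a_nth //; case: (odd p) (a _.+1) => [] [] //=; lia.
Qed.

(** Of two consecutive changed rows, the partition that has the extra box in the second does not
    have it in the first; as its parts decrease, the inequality is strict. *)
Let J_sorted : sorted gtn J.
Proof.
apply/(sortedP 0) => p; rewrite size_map => lt_p.
have [m_p l_p] := lm_I (ltnW lt_p); have [m_q l_q] := lm_I lt_p.
have lt_I : nth 0 I p < nth 0 I p.+1 by apply: (sorted_ltn_nth ltn_trans 0 I_sorted);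
  rewrite ?inE // ltnW.
have := part_nth part_l (ltnW lt_I); have := part_nth part_m (ltnW lt_I).
rewrite /= in m_q l_q *; lia.
Qed.

Let J_lt p q : p < size I -> q < size I -> (nth 0 J p < nth 0 J q) = (q < p).
Proof.
have lt_J p' q' : p' < q' -> q' < size I -> nth 0 J q' < nth 0 J p'.
  move=> lt_pq lt_q; apply: (sorted_ltn_nth (leT := gtn) _ 0 J_sorted) => //.
  - by move=> x y z /= lt_xy lt_yz; apply: ltn_trans lt_xy.
  - by rewrite inE size_map (ltn_trans lt_pq).
  - by rewrite inE size_map.
move=> lt_p lt_q; have [/lt_J->//|lt_pq|->] := ltngtP q p; last exact: ltnn.
by apply/negbTE; rewrite -leqNgt ltnW ?lt_J.
Qed.

Let W := nth 0 m 0.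
(** The columns in [J] go to the abscissas from [W] to [W + M.*2], and the rows in [I] to the
    ordinates from 0 to [M.*2]. As [J] is decreasing, its index is reversed to rank columns by
    decreasing length. *)
Let X j := if j \in J then W + coord M (M.*2 - index j J) else j.
Let Y i := if i \in I then coord M (index i I) else M.*2.+1 + i.
Let row_at u := nth 0 I (coord_rank M u).
Let column_at v := nth 0 J (M.*2 - coord_rank M v).

Let index_I i : i \in I -> index i I <= M.*2.
Proof. by move=> Ii; rewrite -ltnS -size_I index_mem. Qed.

Let index_J j : j \in J -> index j J <= M.*2.
Proof. by move=> Jj; rewrite -ltnS -size_I -(size_map h I) index_mem. Qed.

Let YP i : Y i <= M.*2 /\ i = row_at (Y i) /\ i \in I \/ Y i = M.*2.+1 + i /\ i \notin I.
Proof.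
rewrite /Y /row_at; case: ifP => [Ii|/negbT]; last by right.
by left; have [-> ->] := coordK (index_I Ii); rewrite nth_index.
Qed.

Let XP j : W <= X j <= W + M.*2 /\ j = column_at (X j - W) /\ j \in J \/ X j = j /\ j \notin J.
Proof.
rewrite /X /column_at; case: ifP => [Jj|/negbT]; last by right.
left; have [] := @coordK M (M.*2 - index j J); first exact: leq_subr.
by rewrite addKn leq_addr leq_add2l => -> ->; rewrite subKn ?index_J // nth_index.
Qed.

Let rowK u : u <= M.*2 -> Y (row_at u) = u.
Proof.
move=> le_u; have [eq_u le_r] := coord_rankK le_u; rewrite /Y /row_at.
by rewrite mem_nth ?size_I ?ltnS // index_uniq ?size_I ?ltnS // (sorted_uniq ltn_trans ltnn).
Qed.

Let columnK v : v <= M.*2 -> X (column_at v) = W + v.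
Proof.
move=> le_v; have [eq_v le_r] := coord_rankK le_v; rewrite /X /column_at.
have U_J : uniq J.
  apply: (sorted_uniq (leT := gtn) _ _ J_sorted) => [x y z lt_xy lt_yz|]; last exact: ltnn.
  exact: ltn_trans lt_yz lt_xy.
by rewrite mem_nth ?index_uniq ?size_map ?size_I ?ltnS ?leq_subr // subKn // eq_v.
Qed.

Let mem_at u v : u <= M.*2 -> v <= M.*2 ->
  (column_at v < nth 0 m (row_at u)) = (coord_rank M u < M.*2 - coord_rank M v + (M <= u)) /\
  (column_at v < nth 0 l (row_at u)) = (coord_rank M u < M.*2 - coord_rank M v + (u < M)).
Proof.
move=> le_u le_v; have [_ lt_p] := coord_rankK le_u; rewrite -ltnS -size_I in lt_p.
have lt_q : M.*2 - coord_rank M v < size I by rewrite size_I ltnS leq_subr.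
have [-> ->] := lm_I lt_p; rewrite -/(column_at v) odd_coord_rank -leqNgt.
have := J_lt lt_q lt_p; have := J_lt lt_p lt_q; rewrite /column_at.
by case: (ltnP u M) => /=; lia.
Qed.

Let YI : injective Y.
Proof.
move=> i i' eq_Y.
case: (YP i) => [[le_Y [ei _]]|[Yi _]]; case: (YP i') => [[le_Y' [ei' _]]|[Yi' _]]; try lia.
by rewrite ei ei' eq_Y.
Qed.

Let m_W i j : j < nth 0 m i -> j < W.
Proof. by move=> /leq_trans; apply; apply: part_nth. Qed.

Let l_W i j : j < nth 0 l i -> j < W.
Proof.
move=> /leq_trans; apply; apply: leq_trans (part_nth part_l (leq0n i)) _.
(* Since [a 0] is false, the first part of [l] is at most that of [m]. *)
by have := lm_a 0; rewrite /W [a 0]/a !take0 ltnn addn0 => ->; apply: leq_addr.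
Qed.

Let XI j j' : j < W -> j' < W -> X j = X j' -> j = j'.
Proof.
move=> lt_j lt_j' eq_X.
case: (XP j) => [[le_X [ej _]]|[Xj _]]; case: (XP j') => [[le_X' [ej' _]]|[Xj' _]]; try lia.
by rewrite ej ej' eq_X.
Qed.

(** A box of [l] outside [m] must be [(i, h i)] with [i] in [I], so it lies in the square spanned by
    the rows of [I] and the columns of [J]. *)
Let fixed_box i j : j < nth 0 l i -> M.*2 < Y i \/ X j < W -> j < nth 0 m i.
Proof.
move=> lt_j YX; have lm := lm_a i; have [Ii|nIi] := boolP (i \in I); last first.
  by move: nIi lt_j lm; rewrite mem_I /changed negbK => /eqP->; lia.
rewrite ltnNge; apply/negP => ge_j; have eq_j : j = h i by move: lm; rewrite /h;
  case: (a i) (a i.+1) => [] []; lia.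
have Jj : j \in J by rewrite eq_j map_f.
by case: YX; [case: (YP i) => [[]|[_]]|case: (XP j) => [[]|[_]]]; rewrite ?Ii ?Jj //; lia.
Qed.

Let moved_box i j : j < nth 0 l i -> Y i <= M.*2 -> W <= X j ->
  exists i' j', [/\ j' < nth 0 m i', Y i' <= M.*2, Y i' = Y i + (W + M <= X j) & X j' = X j +
    (Y i < M)].
Proof.
move=> lt_j le_Y le_X; have := l_W lt_j.
case: (XP j) => [[/andP[_ le_X2] [ej _]]|[Xj _]]; last by lia.
case: (YP i) => [[_ [ei _]]|[eY _]]; last by lia.
have [v eq_X] : exists v, X j = W + v by exists (X j - W); rewrite subnKC.
rewrite eq_X addKn in ej *; rewrite eq_X leq_add2l in le_X2.
move: lt_j; rewrite [in X in X -> _]ei [in X in X -> _]ej (mem_at le_Y le_X2).2.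
move=> /(pinwheel le_Y le_X2)[le_u le_v lt_uv] _.
exists (row_at (Y i + (M <= v))), (column_at (v + (Y i < M))).
by rewrite (mem_at le_u le_v).1 rowK // columnK // leq_add2l addnA.
Qed.

(** This keeps the half columns that move up from running into the rows above the diamond. *)
Let moved_le i j : j < nth 0 l i -> Y i <= M.*2 -> W <= X j -> Y i + (W + M <= X j) <= M.*2.
Proof. by move=> lt_j le_Y le_X; have [i' [j' [_ ? <- _]]] := moved_box lt_j le_Y le_X. Qed.

Let point_m b := (X b.2, Y b.1).
(** The pinwheel: in the diamond, rows below the centre move one step to the right, and columns from
    the centre on move one step up. No box lands on the centre. *)
Let point_l b :=
  if (Y b.1 <= M.*2) && (W <= X b.2)
  then (X b.2 + (Y b.1 < M), Y b.1 + (W + M <= X b.2)) else point_m b.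

Lemma pattern_add_box : exists p q,
  [/\ sh p = IntPart part_l, sh q = IntPart part_m & pattern p q].
Proof.
(* Abscissas are at most [W + M.*2] and ordinates at most [M.*2 + size m]. *)
apply: (@pattern_points _ _ (W + M.*2 + size m).+2 point_l point_m) => /=.
- move=> [i j]; rewrite mem_boxes => lt_j; rewrite !inE /point_m /=.
  have lt_i : i < size m by rewrite ltnNge; apply/negP => /(nth_default 0); lia.
  by have := m_W lt_j; have := YP i; have := XP j; lia.
- move=> [i j]; rewrite mem_boxes => lt_j; rewrite /point_l /=; case: ifP => [/andP[le_Y le_X]|nYX].
    have [i' [j' [lt_j' _ eq_Y eq_X]]] := moved_box lt_j le_Y le_X.
    by apply/mapP; exists (i', j'); rewrite ?mem_boxes // /point_m /= eq_X eq_Y.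
  by apply/mapP; exists (i, j); rewrite ?mem_boxes // fixed_box //; lia.
- move=> [i j] [i' j']; rewrite !mem_boxes => lt_j lt_j' eq_pt.
  suff [/YI-> eq_X] : Y i = Y i' /\ X j = X j' by rewrite (XI (l_W lt_j) (l_W lt_j') eq_X).
  have := moved_le lt_j; have := moved_le lt_j'; move: eq_pt; rewrite /point_l /point_m /=.
  move: (X j) (X j') (Y i) (Y i') => x x' y y'.
  by case: ifP => ?; case: ifP => ? [eX eY]; lia.
- move=> [i j] [i' j']; rewrite !mem_boxes => lt_j lt_j' [eX eY].
  by rewrite (YI eY) (XI (m_W lt_j) (m_W lt_j') eX).
(* Rows bend upwards on their way to the right and columns bend to the right on their way down, as
   the weak inequalities in [inc] and [dec] permit. *)
- move=> [i j] [i' j']; rewrite !mem_boxes => lt_j lt_j' ne; split=> /= [ei|ej].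
    have {ne} neX : X j <> X j'.
      by move/(XI (l_W lt_j) (l_W lt_j')) => ej; rewrite ei ej eqxx in ne.
    rewrite /inc /point_l /point_m /= ei; move: (X j) (X j') (Y i') neX => x x' y neX.
    by case: ifP => ?; case: ifP => ? /=; lia.
  have {ne} neY : Y i <> Y i' by move/YI => ei; rewrite ei ej eqxx in ne.
  have := moved_le lt_j; have := moved_le lt_j'; rewrite /dec /point_l /point_m /= ej.
  move: (X j') (Y i) (Y i') neY => x y y' neY.
  by case: ifP => ?; case: ifP => ? /=; lia.
move=> [i j] [i' j']; rewrite !mem_boxes => lt_j lt_j' ne; split=> /= [ei|ej].
  have neX : X j <> X j'.
    by move/(XI (m_W lt_j) (m_W lt_j')) => ej; rewrite ei ej eqxx in ne.
  by rewrite /inc /= ei; lia.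
have neY : Y i <> Y i' by move/YI => ei; rewrite ei ej eqxx in ne.
by rewrite /dec /= ej; lia.
Qed.

End OneBox.

(** * The double domination order *)

Lemma sum_nth_take k l : \sum_(i < k) nth 0 l i = sumn (take k l).
Proof.
elim: k => [|k IHk]; first by rewrite big_ord0 take0.
by rewrite big_ord_recr /= IHk sumn_take_nth.
Qed.

(** Both sides count the boxes in the first [k] columns. *)
Lemma sum_nth_conj k l : is_part l ->
  \sum_(i < k) nth 0 (conj_seq l) i = sumn (map (minn k) l).
Proof.
case/andP=> sorted_l _; rewrite -(sum_count_ltn (n := k)) => [|_ /mapP[x _ ->]];
  last exact: geq_minl.
apply: eq_bigr => i _; rewrite count_map -[RHS](@eq_count _ (leq i.+1)) => [|x]; last first.
  by rewrite /= leq_min ltn_ord.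
have [lt_i|le_i] := ltnP i (head 0 l); first by rewrite nth_mkseq.
rewrite nth_default ?size_mkseq //; apply/esym/eqP; rewrite -leqn0 leqNgt -has_count.
apply/hasPn => x lx; rewrite -leqNgt; apply: leq_trans le_i.
case: l sorted_l lx => //= a l path_l; rewrite inE => /predU1P[->//|lx].
by have /allP/(_ x lx) := order_path_min (rev_trans leq_trans) path_l.
Qed.

(** Cap all parts at [nth 0 l k]: the first [k] parts of [l] become equal to the cap, those of [m]
    are at most the cap, and the tail of [l] does not change. *)
Lemma conj_dominated_tail l m : is_part l -> is_part m ->
    (forall k, sumn (map (minn k) l) <= sumn (map (minn k) m)) ->
  forall k, sumn (drop k l) <= sumn (drop k m).
Proof.
move=> part_l part_m le_lm k; have := le_lm (nth 0 l k); set c := nth 0 l k.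
have [ge_k|lt_k] := leqP (size l) k; first by rewrite drop_oversize.
have minn_le s : sumn (map (minn c) s) <= size s * c.
  by elim: s => //= x s IHs; rewrite mulSn leq_add // geq_minl.
have minn_ge s : {in s, forall x, c <= x} -> sumn (map (minn c) s) = size s * c.
  elim: s => //= x s IHs c_s; rewrite IHs => [|y sy]; last by rewrite c_s // inE sy orbT.
  by rewrite mulSn (minn_idPl _) // c_s // mem_head.
have minn_drop s : sumn (map (minn c) s) <= sumn s.
  by elim: s => //= x s IHs; rewrite leq_add // geq_minr.
rewrite -{1}(cat_take_drop k l) -{1}(cat_take_drop k m) !map_cat !sumn_cat.
rewrite minn_ge => [|x /(nthP 0)[i]]; last first.
  rewrite size_take lt_k => lt_i; rewrite nth_take // => <-.
  exact: part_nth (ltnW lt_i).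
have -> : map (minn c) (drop k l) = drop k l.
  rewrite -[RHS]map_id; apply/eq_in_map => x /(nthP 0)[i _ <-].
  by apply/minn_idPr; rewrite nth_drop part_nth ?leq_addr.
have := minn_le (take k m); have := minn_drop (drop k m).
have : size (take k m) * c <= size (take k l) * c.
  by rewrite leq_mul2r size_take_min size_take lt_k geq_minl orbT.
move=> le_size le_drop le_take le_cut; rewrite -(leq_add2l (size (take k l) * c)).
exact: leq_trans le_cut (leq_add (leq_trans le_take le_size) le_drop).
Qed.

Lemma eq_part_sums l m : is_part l -> is_part m ->
  (forall k, sumn (take k l) = sumn (take k m)) -> l = m.
Proof.
elim: l m => [|a l IHl] [|b m] //.
- by move=> _ /andP[_]; rewrite inE => /norP[b0 _] /(_ 1); rewrite /= take0 /=; lia.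
- by move=> /andP[_]; rewrite inE => /norP[a0 _] _ /(_ 1); rewrite /= take0 /=; lia.
rewrite /is_part /= !inE !negb_or.
case/andP=> path_l /andP[_ l0] /andP[path_m /andP[_ m0]] eq_sum.
have eq_ab : a = b by have := eq_sum 1; rewrite /= !take0 /= !addn0.
subst b; congr cons; apply: IHl.
- by rewrite /is_part (path_sorted path_l).
- by rewrite /is_part (path_sorted path_m).
- by move=> k; have := eq_sum k.+1; rewrite /=; lia.
Qed.

(** The parts are the successive differences of [F]; concavity makes them decrease. *)
Lemma part_of_sums (F : nat -> nat) n : F 0 = 0 -> (forall k, F k <= F k.+1) ->
    (forall k, F k.+2 + F k <= F k.+1 + F k.+1) -> (forall k, n <= k -> F k = F n) ->
  exists l : intpart, forall k, sumn (take k l) = F k.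
Proof.
elim: n F => [|n IHn] F F0 F_mono F_conc F_n.
  by exists (@IntPart [::] isT) => k; rewrite F_n.
(* Zero is not a part: if [F 1] is 0, then [F] vanishes by concavity and the partition is empty. *)
have [F1|F1] := posnP (F 1).
  exists (@IntPart [::] isT); elim=> [|k IHk] //=.
  have F_step j : F j.+1 <= F j; last by have := F_step k; have := F_mono k; rewrite -IHk /=; lia.
  by elim: j => [|j IHj]; [lia | have := F_conc j; lia].
have F1_le k : F 1 <= F k.+1 by elim: k => // k /leq_trans; apply.
have [|k|k|k le_k|l sum_l] := IHn (fun k => F k.+1 - F 1).
- exact: subnn.
- by rewrite leq_sub2r.
- by have := F_conc k.+1; have := F1_le k; have := F1_le k.+1; have := F1_le k.+2; lia.
- by rewrite F_n.
have part_l : is_part (F 1 :: l).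
  case: l sum_l => -[|a l] part_al sum_l;
    rewrite /is_part /= !inE ?negb_or [0 == F 1]eq_sym -lt0n F1 //=.
  have := part_al; rewrite /is_part inE negb_or /= => /andP[-> /andP[-> ->]]; rewrite !andbT.
  by have := sum_l 1; rewrite /= take0 /= addn0 => ->; have := F_conc 0; rewrite F0; lia.
exists (IntPart part_l) => -[|k] /=; first by rewrite F0.
by rewrite sum_l; have := F1_le k; lia.
Qed.

(* The intermediate partition has the partial sums F, a minimum of two concave
   sequences. *)
Lemma dominance_interval_ind (D : set intpart) :
    (forall p q, pattern p q -> D (sh q) -> D (sh p)) ->
  forall d (l m : intpart), sumn m = sumn l + d ->
    (forall k, sumn (take k l) <= sumn (take k m) <= sumn (take k l) + d) -> D m -> D l.
Proof.
move=> D_pat; elim=> [|d IHd] l m sum_m le_sums Dm.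
  suff <- : m = l by [].
  apply: val_inj; apply: eq_part_sums; [exact: valP | exact: valP | move=> k].
  by have := le_sums k; rewrite /=; lia.
pose F k := minn (sumn (take k m)) (sumn (take k l) + d).
have dec_nth (n : intpart) k : nth 0 n k.+1 <= nth 0 n k by apply: part_nth => //; apply: valP.
have F_big k : size m + size l <= k -> F k = sumn l + d.
  by move=> le_k; rewrite /F !take_oversize; lia.
have [|k|k|k le_k|n sum_n] := @part_of_sums F (size m + size l).
- by rewrite /F !take0 /= min0n.
- by rewrite /F !sumn_take_nth; lia.
- by rewrite /F !sumn_take_nth; have := dec_nth l k; have := dec_nth m k; lia.
- by rewrite !F_big.
have sumn_n : sumn n = sumn l + d.
  by have := sum_n (size n + (size m + size l)); rewrite F_big ?leq_addl // take_oversize ?leq_addr.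
(* From [n] down to [l] the excess is at most [d], so induction applies; from [m] to [n] a single
   box is lost. *)
have Dn : D n; last first.
  by apply: (IHd _ n) => // k; rewrite sum_n /F; have := le_sums k; lia.
have [k||p [q [sh_p sh_q pq]]] := @pattern_add_box n m (valP n) (valP m).
- by rewrite sum_n /F; have := le_sums k; lia.
- by rewrite sumn_n; lia.
have nE (n' : intpart) : IntPart (valP n') = n' by apply: val_inj.
by move: (D_pat p q pq); rewrite sh_p sh_q !nE; apply.
Qed.

(** * Young classes and downwards closed sets of shapes *)

Local Open Scope classical_set_scope.

Theorem theorem7 (C : set permutation) (C_class : perm_class C) :
  Young_class C <->
  exists D : set intpart, dd_closed D /\ C = [set p | D (sh p)].
Proof.
split=> [[_ C_Young]|[D [_ eq_C]]]; last first.
  split=> // l; have [Dl|nDl] := EM (D l); [left | right] => p sh_p.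
    by rewrite eq_C /= sh_p.
  by rewrite eq_C /= sh_p.
have C_sh p q : sh p = sh q -> C p -> C q.
  by move=> eq_sh Cp; case: (C_Young (sh p)) => [allC|/(_ p erefl)/(_ Cp)//]; apply: allC.
exists [set l | exists2 p, sh p = l & C p]; split; last first.
  apply/seteqP; split=> p /= => [Cp|[q sh_q Cq]]; first by exists p.
  exact: C_sh Cq.
move=> l m Dm [le_lm le_conj].
have le_rows k : sumn (take k l) <= sumn (take k m) by have := le_lm k; rewrite !sum_nth_take.
have le_tails k : sumn (drop k l) <= sumn (drop k m).
  apply: conj_dominated_tail => [||j]; [exact: valP | exact: valP | rewrite -!sum_nth_conj].
  - exact: le_conj.
  - exact: valP.
  - exact: valP.
have sum_cat k (n : seq nat) : sumn n = sumn (take k n) + sumn (drop k n).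
  by rewrite -sumn_cat cat_take_drop.
apply: (@dominance_interval_ind _ _ (sumn m - sumn l) l m) Dm.
- move=> p q pq [r sh_r Cr]; exists p => //.
  exact: C_class (C_sh _ _ sh_r Cr) pq.
- by have := le_tails 0; rewrite !drop0; lia.
(* The excesses of the first [k] parts and of the tails add up to [sumn m - sumn l], so the former
   is at most this. *)
move=> k; have := le_tails k; have := le_tails 0; have := le_rows k; rewrite !drop0.
by have := sum_cat k l; have := sum_cat k m; lia.
Qed.
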